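(* Fix $\pi_0,\pi_1\in\mathcal P_{\mathcal X}$ with $\pi_1\ll\pi_0$, let $R$ be a reward function, and take the canonical action space $(\mathcal A,\phi)=(\mathcal P^{\pi_0},\phi^{\pi_0})$. Then $$\sup_{U^\infty\text{ e-process}}\mathbb E_{\pi_1^\otimes}\bigl[R(\tau^{U^\infty})\bigr]=\sup_{A^\infty}\mathbb E_{\pi_1^\otimes}\bigl[R(\tau^{A^\infty})\bigr]=\sup_{a^\infty\text{ Markov}}\mathbb E_{\pi_1^\otimes}\bigl[R(\tau^{a^\infty})\bigr],$$ where the suprema are over all e-processes $U^\infty$ for the null $\pi_0^\otimes$, all policies $A^\infty$, and all Markov policies $a^\infty$, respectively.
   Context: Notation: $\mathbb N=\{0,1,2,\dots\}$, $\mathbb R_+=[0,\infty)$, $\inf\emptyset=\infty$. For a sequence $x_1,x_2,\dots$, $x^t=(x_1,\dots,x_t)$ ($x^0$ is the empty history) and $x^\infty$ is the full sequence. $\mathcal X$ is a standard Borel space, $\mathcal P_{\mathcal X}$ is the set of Borel probability measures on $\mathcal X$. For $\pi\in\mathcal P_{\mathcal X}$, $\pi^\otimes$ is the infinite product measure on $\mathcal X^\infty$. A level $\alpha\in(0,1)$ is fixed. A reward function is a non-increasing map $R:\mathbb N\cup\{\infty\}\to\mathbb R_+$ with $R(\infty)=0$. Canonical action space: $\mathcal P^{\pi_0}=\{\nu\in\mathcal P_{\mathcal X}:\nu\ll\pi_0\}$, with the $\sigma$-field generated by the evaluation maps $\nu\mapsto\nu(B)$, $B\subseteq\mathcal X$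 Borel; this is a standard Borel space. $\phi^{\pi_0}:\mathcal P^{\pi_0}\times\mathcal X\to\mathbb R_+$ is a (jointly) Borel map such that for every $\nu\in\mathcal P^{\pi_0}$, $x\mapsto\phi^{\pi_0}(\nu,x)$ is a version of $\mathrm d\nu/\mathrm d\pi_0$ (such a map exists). An e-process for $\pi_0^\otimes$ is a sequence $U^\infty=(U_t)_{t\ge0}$ of Borel maps $U_t:\mathcal X^t\to\mathbb R_+$ such that $\mathbb E_{\pi_0^\otimes}[U_\tau]\le1$ for every stopping time $\tau$ of the natural filtration of the observations (with $U_\infty:=\limsup_{t}U_t$ when $\tau$ may be infinite). Its rejection time is $\tau^{U^\infty}=\inf\{t\ge0:U_t\ge\alpha^{-1}\}$. A policy is a sequence $A^\infty=(A_t)_{t\ge1}$ of Borel maps $A_t:\mathcal X^{t-1}\to\mathcal A$. Its wealth process is defined by $\widehat W_0^{A^\infty}=1$ and $\widehat W_t^{A^\infty}(x^t)=\widehat W_{t-1}^{A^\infty}(x^{t-1})\,\phi(A_t(x^{t-1}),x_t)$, and its rejection time is $\tau^{A^\infty}(x^\infty)=\inf\{t\ge1:\widehat W_t^{A^\infty}(x^t)\ge\alpha^{-1}\}$. A Markov policy is a sequence $a^\infty=(a_t)_{t\ge0}$ of Borel maps $a_t:[0,\alpha^{-1})\to\mathcal A$. It is identified with any policy which, after $t$ rounds have been played with current wealth $w<\alpha^{-1}$, chooses the action $a_t(w)$ for the bet on $x_{t+1}$ (the action chosen once the wealth has reached $\alpha^{-1}$ is irrelevant). Thus the wealth starts from $1$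 and evolves, until it first reaches $\alpha^{-1}$, by $W_{t+1}=W_t\,\phi(a_t(W_t),x_{t+1})$; $\tau^{a^\infty}$ is the first $t\ge1$ with $W_t\ge\alpha^{-1}$ ($\infty$ if there is none). *)

(* Defs.v *)
From HB Require Import structures.
From mathcomp Require Import all_boot all_order all_algebra.
From mathcomp Require Import all_classical all_reals all_analysis.
From mathcomp Require Import measurable_realfun.
Set Implicit Arguments.
Unset Strict Implicit.
Unset Printing Implicit Defensive.
Import Order.TTheory GRing.Theory Num.Theory.
Import numFieldNormedType.Exports.
Local Open Scope classical_set_scope.
Local Open Scope ring_scope.

(* X is isomorphic, as a measurable space, to a complete separable metric space
   with its Borel sigma-algebra. *)
Definition standard_borel (R : realType) (d : measure_display)
    (X : measurableType d) : Prop :=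
  exists (T : metricType R) (f : X -> T),
    [/\ forall F : set_system T, ProperFilter F -> cauchy F ->
          exists l : T, F --> l,
        exists2 D : set T, countable D & dense D,
        bijective f &
        forall A : set X, measurable A <-> <<s [set O : set T | open O] >> (f @` A)].

Section observations.
Context {d : measure_display} (X : measurableType d).

Definition coordinate_sets : set (set (nat -> X)) :=
  \bigcup_n preimage_set_system [set: nat -> X] (fun x => x n) measurable.

(* X^oo with the product sigma-algebra.  Observations are numbered from 1 in
   the mathematics and from 0 here: [x t] is the observation x_(t+1). *)
Definition obs_seq : measurableType coordinate_sets.-sigma :=
  g_sigma_algebraType coordinate_sets.

(* The history x^t = (x_1, ..., x_t). *)
Definition history (t : nat) (x : nat -> X) : t.-tuple X :=
  [tuple x i | i < t].

Definition natural_filtration (t : nat) : set (set obs_seq) :=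
  preimage_set_system [set: obs_seq] (history t) measurable.

(* The product rule on finite-dimensional rectangles, which determines the
   infinite product measure uniquely (they form a generating pi-system). *)
Definition is_infinite_product (R : realType) (pi : probability X R)
    (P : probability obs_seq R) : Prop :=
  forall (n : nat) (B : nat -> set X), (forall i, measurable (B i)) ->
    P [set x | forall i, (i < n)%N -> B i (x i)] = (\prod_(i < n) pi (B i))%E.

End observations.

(* Times in N \cup {oo} are of type [option nat], with [None] for infinity. *)
Definition time_le (s t : option nat) : bool :=
  match s, t with
  | _, None => true
  | Some m, Some n => (m <= n)%N
  | None, Some _ => false
  end.

(* The infimum of {t | p t}, with inf of the empty set equal to infinity. *)
Definition first_time (p : pred nat) : option nat :=
  match pselect (exists t, p t) with
  | left h => Some (ex_minn h)
  | right _ => None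
  end.

Definition stopping_time {d : measure_display} {X : measurableType d}
    (tau : obs_seq X -> option nat) : Prop :=
  forall t, natural_filtration t [set x | time_le (tau x) (Some t)].

Section rewards.
Context {R : realType}.

Definition reward_function (r : option nat -> R) : Prop :=
  [/\ forall t, 0 <= r t,
      forall s t, time_le s t -> r t <= r s &
      r None = 0].

Definition expected_reward {d : measure_display} {X : measurableType d}
    (P : probability (obs_seq X) R) (r : option nat -> R)
    (tau : obs_seq X -> option nat) : \bar R :=
  (\int[P]_x (r (tau x))%:E)%E.

End rewards.

Section eprocesses.
Context {R : realType} {d : measure_display} {X : measurableType d}.
Implicit Type U : forall t : nat, t.-tuple X -> R.

(* U_tau, with U_oo = limsup_t U_t. *)
Definition stopped U (tau : obs_seq X -> option nat) (x : obs_seq X) : \bar R :=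
  match tau x with
  | Some t => (U t (history t x))%:E
  | None => limn_esup (fun t => (U t (history t x))%:E)
  end.

Definition e_process (P : probability (obs_seq X) R) U : Prop :=
  [/\ forall t, measurable_fun [set: t.-tuple X] (U t),
      forall t h, 0 <= U t h &
      forall tau, stopping_time tau -> (\int[P]_x stopped U tau x <= 1)%E].

Definition eprocess_rejection (alpha : R) U (x : obs_seq X) : option nat :=
  first_time (fun t => alpha^-1 <= U t (history t x)).

End eprocesses.

Section policies.
Context {R : realType} {d dA : measure_display}.
Context {X : measurableType d} {A : measurableType dA}.
Variables (alpha : R) (phi : A -> X -> R).

(* [a t] is the action A_(t+1), which bets on x_(t+1). *)
Definition policy (a : forall t : nat, t.-tuple X -> A) : Prop :=
  forall t, measurable_fun [set: t.-tuple X] (a t).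

Fixpoint wealth (a : forall t : nat, t.-tuple X -> A) (x : obs_seq X)
    (t : nat) : R :=
  if t is s.+1 then wealth a x s * phi (a s (history s x)) (x s) else 1.

Definition policy_rejection (a : forall t : nat, t.-tuple X -> A)
    (x : obs_seq X) : option nat :=
  first_time (fun t => (0 < t)%N && (alpha^-1 <= wealth a x t)).

(* The maps a_t are total for convenience, but measurability is only required
   on [0, 1/alpha[ and values elsewhere are never used. *)
Definition markov_policy (a : nat -> R -> A) : Prop :=
  forall t, measurable_fun `[0, alpha^-1[%classic (a t).

(* The wealth is frozen once it has reached 1/alpha: the actions chosen from
   then on do not affect the rejection time. *)
Fixpoint markov_wealth (a : nat -> R -> A) (x : obs_seq X) (t : nat) : R :=
  if t is s.+1 then
    let w := markov_wealth a x s in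
    if w < alpha^-1 then w * phi (a s w) (x s) else w
  else 1.

Definition markov_rejection (a : nat -> R -> A) (x : obs_seq X) : option nat :=
  first_time (fun t => (0 < t)%N && (alpha^-1 <= markov_wealth a x t)).

End policies.

(* Library measures are functions on all sets, so two elements may agree on every
   measurable set without being equal.  The sigma-algebra generated by the
   evaluations does not separate such elements, so that measurable maps on
   [canonical_action] only depend on the values on measurable sets. *)
Record dominated {R : realType} {d : measure_display} {X : measurableType d}
    (pi0 : probability X R) := Dominated {
  dominated_val :> probability X R;
  dominatedP : dominated_val `<< pi0 }.

Section canonical_actions.
Context {R : realType} {d : measure_display} {X : measurableType d}.
Variable pi0 : probability X R.

HB.instance Definition _ := gen_eqMixin (dominated pi0).
HB.instance Definition _ := gen_choiceMixin (dominated pi0).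
HB.instance Definition _ :=
  isPointed.Build (dominated pi0) (@Dominated _ _ _ pi0 pi0 (fun _ => id)).

Definition evaluation_sets : set (set (dominated pi0)) :=
  \bigcup_(B in measurable)
    preimage_set_system [set: dominated pi0] (fun nu => nu B)
      measurable.

(* P^pi0 with the sigma-algebra generated by the evaluations nu |-> nu B. *)
Definition canonical_action : measurableType evaluation_sets.-sigma :=
  g_sigma_algebraType evaluation_sets.

(* phi is jointly Borel and phi nu is a version of dnu/dpi0 for every nu. *)
Definition canonical_payoff (phi : canonical_action -> X -> R) : Prop :=
  [/\ measurable_fun [set: canonical_action * X] (fun z => phi z.1 z.2),
      forall nu x, 0 <= phi nu x &
      forall (nu : canonical_action) (B : set X), measurable B ->
        dominated_val nu B = (\int[pi0]_(x in B) (phi nu x)%:E)%E].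

End canonical_actions.

(* Main.v *)
(* The product law of x_1, x_2, ... is the law of x_1 times the law of the
   shifted sequence, so it suffices to condition on the first observation and
   to induct on a finite horizon; conditional expectations never appear.

   A Markov policy is a policy, and the rejection time tau of a policy satisfies
   P0(tau < oo) <= alpha (Ville), so 1/alpha times the indicator of tau <= t is
   an e-process with the same rejection time.  Conversely the rejection time tau
   of an e-process has P0(tau < oo) <= alpha.  It remains to show that, for a
   reward vanishing after a finite time, Markov policies started from wealth w
   do as well, up to eps, as all tau with P0(tau < oo) <= alpha * w.  After the
   first observation x the remaining time tau_x costs P0(tau_x < oo), and betting
   on the normalized density of x |-> P0(tau_x < oo) finances it from w.  The
   optimal value is nondecreasing in w, so countably many bets suffice and
   measurability in w is automatic: the bet chosen for a slightly less valuable,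
   smaller wealth still finances enough. *)
Require Import Defs.
From HB Require Import structures.
From mathcomp Require Import all_boot all_order all_algebra.
From mathcomp Require Import all_classical all_reals all_analysis.
From mathcomp Require Import measurable_realfun.
From mathcomp Require Import ring.
Set Implicit Arguments.
Unset Strict Implicit.
Unset Printing Implicit Defensive.
Import Order.TTheory GRing.Theory Num.Theory.
Import numFieldNormedType.Exports.
Local Open Scope classical_set_scope.
Local Open Scope ring_scope.

(** The integral of a nonnegative function is a supremum over the simple functions below it, hence
    monotone on all such functions. [stopped] processes are compared this way without proving them
    measurable. *)
Lemma ge0_le_integralT (R : realType) (d : measure_display)
    (T : measurableType d) (mu : measure T R) (f g : T -> \bar R) :
  (forall x, 0 <= f x)%E -> (forall x, f x <= g x)%E ->
  (\int[mu]_x f x <= \int[mu]_x g x)%E.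
Proof.
move=> f0 fg; rewrite !ge0_integralTE//; last by move=> x; exact: le_trans (f0 x) (fg x).
apply: ereal_sup_le => _ [h hf <-]; exists h => // x.
exact: le_trans (hf x) (fg x).
Qed.

(** * The product measure as a law invariant under prepending *)

Definition obs_cons {d : measure_display} {X : measurableType d}
    (z : X * obs_seq X) : obs_seq X :=
  fun n => if n is m.+1 then z.2 m else z.1.

Section coordinates.
Context {d : measure_display} {X : measurableType d}.
Implicit Types (x : X) (s : obs_seq X).

Lemma measurable_coordinate n :
  measurable_fun [set: obs_seq X] (fun s => s n).
Proof. by move=> _ B mB; apply: sub_sigma_algebra; exists n => //; exists B. Qed.

Lemma measurable_obs_seq {dT : measure_display} (T : measurableType dT)
    (f : T -> obs_seq X) :
  (forall n, measurable_fun [set: T] (fun t => f t n)) ->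
  measurable_fun [set: T] f.
Proof.
move=> mf; apply: (@measurability _ _ T (obs_seq X) setT f (@coordinate_sets _ X) erefl).
move=> _ [_ [n _ [B mB <-]] <-].
have := mf n measurableT B mB.
by rewrite !setTI.
Qed.

Lemma measurable_obs_cons : measurable_fun [set: X * obs_seq X] obs_cons.
Proof.
apply: measurable_obs_seq => -[|n] /=; first exact: measurable_fst.
exact: (measurableT_comp (measurable_coordinate n) measurable_snd).
Qed.

Lemma measurable_obs_cons1 x : measurable_fun [set: obs_seq X] (fun s => obs_cons (x, s)).
Proof. exact: measurableT_comp measurable_obs_cons (pair1_measurable x). Qed.

Lemma measurable_history t : measurable_fun [set: obs_seq X] (history t : obs_seq X -> _).
Proof.
apply/measurable_fun_tnthP => i.
by rewrite (_ : _ \o _ = fun s => s i); [exact: measurable_coordinate|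
  apply/funext => s /=; rewrite tnth_mktuple].
Qed.

Lemma history_obs_cons t x s :
  history t.+1 (obs_cons (x, s)) = [tuple of x :: history t s].
Proof.
apply: eq_from_tnth => i; rewrite tnth_mktuple.
by case: (unliftP ord0 i) => [j|] ->; rewrite ?tnthS ?tnth0 ?tnth_mktuple.
Qed.

Lemma obs_consK s : obs_cons (s 0%N, fun n => s n.+1) = s.
Proof. by apply/funext => -[]. Qed.

End coordinates.

Section infinite_product.
Context {R : realType} {d : measure_display} {X : measurableType d}.
Variables (pi : probability X R) (P : probability (obs_seq X) R).
Hypothesis P_prod : is_infinite_product pi P.

Definition cylinder n (B : nat -> set X) : set (obs_seq X) :=
  [set x | forall i, (i < n)%N -> B i (x i)].

Definition cylinders : set (set (obs_seq X)) :=
  [set C | exists n, exists2 B, (forall i, measurable (B i)) & C = cylinder n B].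

Lemma measurable_cylinder n (B : nat -> set X) :
  (forall i, measurable (B i)) -> measurable (cylinder n B).
Proof.
move=> mB; rewrite (_ : cylinder n B =
  \bigcap_(i in [set i | (i < n)%N]) ((fun s : obs_seq X => s i) @^-1` B i)) //.
apply: bigcap_measurableType => i _.
by rewrite -[X in measurable X]setTI; exact: measurable_coordinate.
Qed.

Lemma cylinders_generate :
  @measurable _ (obs_seq X) = <<s cylinders >>.
Proof.
apply/seteqP; split.
  apply: smallest_sub; first exact: smallest_sigma_algebra.
  move=> _ [n _ [B mB <-]]; apply: sub_sigma_algebra.
  exists n.+1; exists (fun i => if i == n then B else setT).
    by move=> i; case: ifP.
  apply/seteqP; split=> [s [_ sB] i _|s sB] /=.
    by case: eqP => // ->.
  by split=> //; have := sB n (ltnSn n); rewrite eqxx.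
apply: smallest_sub; first exact: sigma_algebra_measurable.
by move=> _ [n [B mB ->]]; exact: measurable_cylinder.
Qed.

Lemma cylinders_setI : setI_closed cylinders.
Proof.
move=> _ _ [n [B mB ->]] [m [C mC ->]].
(* Padding with full factors brings both cylinders to a common length. *)
exists (maxn n m); exists (fun i => (if (i < n)%N then B i else setT) `&`
                               (if (i < m)%N then C i else setT)).
  by move=> i; apply: measurableI; case: ifP.
apply/seteqP; split=> [s [sB sC] i _|s sBC].
  by split; case: ifP => // ?; [exact: sB|exact: sC].
split=> i im; have /= := sBC i; rewrite leq_max im ?orbT => /(_ isT) [];
by rewrite ?im.
Qed.

(** Cylinders form a generating pi-system, and prepending an independent draw gives a cylinder one
    more factor, as the product rule demands. *)
Lemma infinite_product_obs_cons (A : set (obs_seq X)) : measurable A ->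
  P A = (pi \x P)%E (obs_cons @^-1` A).
Proof.
move=> mA.
(* The pushforward is a measure by virtue of the measurability of [obs_cons]; [m2] bundles the
   two. *)
have [m2 m2E] : exists m2 : measure (obs_seq X) R,
    m2 = pushforward (pi \x P)%E obs_cons :> (set (obs_seq X) -> \bar R).
  pose m : measure (obs_seq X) R := pushforward (pi \x P)%E obs_cons.
  by exists (m measurable_obs_cons).
transitivity (m2 A); last by rewrite m2E.
apply: (@measure_unique _ R (obs_seq X) cylinders (fun=> setT) _ _ _ _ P m2 _ _ _ mA) => //.
- exact: cylinders_generate.
- exact: cylinders_setI.
- by move=> _; exists 0%N; exists (fun=> setT) => //; apply/seteqP; split.
- by apply/seteqP; split=> // x _; exists 0%N.
- move=> _ [[|n] [B mB ->]].
    have -> : cylinder 0 B = setT by apply/seteqP; split.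
    rewrite m2E /pushforward preimage_setT -setXTT product_measure1E//.
    apply: (@etrans _ _ 1%E); first exact: probability_setT.
    rewrite -[1%E]mule1; congr (_ * _)%E; symmetry; exact: probability_setT.
  apply: (etrans (P_prod n.+1 mB)); rewrite big_ord_recl /=.
  rewrite m2E /pushforward (_ : _ @^-1` _ = B 0%N `*` cylinder n (fun i => B i.+1)).
    rewrite product_measure1E//; first by congr (_ * _)%E; symmetry; exact: (P_prod n).
    exact: measurable_cylinder.
  apply/seteqP; split=> [[x s] h|[x s] [h0 hS] [|i]] //=.
  - by split=> [|i ?]; [exact: (h 0%N)|exact: (h i.+1)].
  - by exact: hS.
- by move=> _; rewrite ltey_eq fin_num_measure.
Qed.

Lemma probability_obs_cons (A : set (obs_seq X)) : measurable A ->
  P A = (\int[pi]_x P [set s | A (obs_cons (x, s))])%E.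
Proof.
move=> mA; rewrite infinite_product_obs_cons// /product_measure1.
apply: eq_integral => x _ /=; congr (P _).
by rewrite xsectionE.
Qed.

Lemma measurable_probability_obs_cons (A : set (obs_seq X)) : measurable A ->
  measurable_fun [set: X] (fun x => P [set s | A (obs_cons (x, s))]).
Proof.
move=> mA.
have mcA : measurable (obs_cons @^-1` A).
  by rewrite -[X in measurable X]setTI; exact: measurable_obs_cons.
have := measurable_fun_xsection P mcA.
congr measurable_fun; apply/funext => x /=; congr (P _).
by rewrite xsectionE.
Qed.

Lemma integral_obs_cons (F : obs_seq X -> \bar R) :
  measurable_fun setT F -> (forall s, 0 <= F s)%E ->
  (\int[P]_s F s = \int[pi]_x \int[P]_s F (obs_cons (x, s)))%E.
Proof.
move=> mF F0.
transitivity (\int[(pi \x P)%E]_z F (obs_cons z))%E; last first.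
  by rewrite fubini_tonelli1//; exact: measurableT_comp mF measurable_obs_cons.
have := @ge0_integral_pushforward _ _ _ _ R _ measurable_obs_cons (pi \x P)%E setT F
  measurableT mF (fun s _ => F0 s).
rewrite preimage_setT => <-; apply: (@eq_measure_integral _ _ _ setT).
  exact: measurable_obs_cons.
move=> ? A mA _; exact: infinite_product_obs_cons.
Qed.

Lemma measurable_integral_obs_cons (F : obs_seq X -> \bar R) :
  measurable_fun setT F -> (forall s, 0 <= F s)%E ->
  measurable_fun [set: X] (fun x => \int[P]_s F (obs_cons (x, s)))%E.
Proof.
move=> mF F0.
apply: (@measurable_fun_fubini_tonelli_F _ _ _ _ _ P (F \o obs_cons)).
  exact: measurableT_comp mF measurable_obs_cons.
by move=> z; exact: F0.
Qed.

End infinite_product.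

(** * Adapted times *)

Lemma time_leS (o : option nat) t :
  time_le (omap predn o) (Some t) = time_le o (Some t.+1).
Proof. by case: o => [[|n]|]. Qed.

Lemma time_le_first_time (p : pred nat) t :
  time_le (first_time p) (Some t) <-> exists2 s, (s <= t)%N & p s.
Proof.
rewrite /first_time; case: pselect => [h|h] /=; last first.
  by split=> // -[s _ ps]; case: h; exists s.
case: ex_minnP => m pm m_min; split=> [mt|[s st ps]]; first by exists m.
exact: leq_trans (m_min s ps) st.
Qed.

Lemma first_time_isSome (p : pred nat) : first_time p <-> exists t, p t.
Proof. by rewrite /first_time; case: pselect. Qed.

Lemma first_time_Some (p : pred nat) t : first_time p = Some t -> p t.
Proof.
by rewrite /first_time; case: pselect => // h [<-]; case: ex_minnP.
Qed.

Lemma time_eqP (a b : option nat) :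
  (forall t, time_le a (Some t) = time_le b (Some t)) -> a = b.
Proof.
case: a b => [m|] [n|] h //.
- by congr Some; apply/eqP; rewrite eqn_leq -/(time_le (Some m) (Some n)) h /= leqnn
    -/(time_le (Some n) (Some m)) -h /= leqnn.
- by have := h m; rewrite /= leqnn.
- by have := h n; rewrite /= leqnn.
Qed.

Section adapted_times.
Context {d : measure_display} {X : measurableType d}.
Implicit Types (tau : obs_seq X -> option nat) (s : obs_seq X).

(** Adaptedness in pointwise form: the event is measurable and blind to the observations from index
    t on. This form passes directly to shifted times; [stopping_time_of_adapted] recovers the
    filtration. *)
Definition adapted_time tau := forall t,
  measurable [set s | time_le (tau s) (Some t)] /\
  forall s s', (forall i, (i < t)%N -> s i = s' i) ->
    time_le (tau s) (Some t) -> time_le (tau s') (Some t).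

(** The time left to run once x has been observed. The truncated predecessor keeps a time 0 at 0. *)
Definition shift_time tau (x : X) s := omap predn (tau (obs_cons (x, s))).

Lemma adapted_shift_time tau x : adapted_time tau -> adapted_time (shift_time tau x).
Proof.
move=> tau_ad t; have [mt dt] := tau_ad t.+1; split.
  have := measurable_obs_cons1 x measurableT mt.
  rewrite setTI; congr measurable; apply/seteqP; split=> s /=;
  by rewrite /shift_time time_leS.
move=> s s' ss'; rewrite /shift_time !time_leS; apply: dt => -[|i] //= it.
exact: ss'.
Qed.

(** Any two sequences agree on their first 0 entries, so stopping at time 0 is all or nothing. *)
Lemma adapted_time0 tau : adapted_time tau ->
  (forall s, tau s = Some 0%N) \/ (forall s, tau s <> Some 0%N).
Proof.
move=> /(_ 0%N)[_ d0]; have [[s ts]|h] := pselect (exists s, tau s = Some 0%N).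
  left=> s'; have := d0 s s'; rewrite ts => /(_ (fun i => ltac:(by [])) isT).
  by case: (tau s') => [[|n]|].
by right=> s ts; case: h; exists s.
Qed.

(** An adapted time has countably many values with measurable level sets, so any preimage under [g]
    is a countable union of these; [pickle] numbers the values. *)
Lemma measurable_adapted_time tau {dT : measure_display} (T : measurableType dT)
    (g : option nat -> T) : adapted_time tau ->
  measurable_fun [set: obs_seq X] (fun s => g (tau s)).
Proof.
move=> tau_ad; have mle t := (tau_ad t).1.
have meq o : measurable [set s | tau s = o].
  case: o => [[|t]|].
  - rewrite (_ : [set s | _] = [set s | time_le (tau s) (Some 0%N)]) //.
    by apply/seteqP; split=> s /=; case: (tau s) => [[|n]|].
  - rewrite (_ : [set s | _] = [set s | time_le (tau s) (Some t.+1)] `\`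
                               [set s | time_le (tau s) (Some t)]).
      exact: measurableD.
    apply/seteqP; split=> s /=; first by move=> ts; split; rewrite /= ts /= ?leqnn ?ltnn.
    case: (tau s) => [n|] [//=] nt /negP; rewrite -ltnNge => tn.
    by congr Some; apply/eqP; rewrite eqn_leq nt.
  - rewrite (_ : [set s | _] = ~` \bigcup_t [set s | time_le (tau s) (Some t)]).
      by apply: measurableC; exact: bigcup_measurable.
    apply/seteqP; split=> s /=; first by move=> ts [n _]; rewrite /= ts.
    by move=> h; case ts : (tau s) => [n|] //; case: h; exists n => //=; rewrite ts /=.
move=> _ B mB; rewrite setTI.
rewrite (_ : _ @^-1` B = \bigcup_(n in [set n | exists2 o, B (g o) & pickle o = n])
    [set s | pickle (tau s) = n]).
  apply: bigcup_measurable => n _.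
  have [[v <-]|h] := pselect (exists v : option nat, pickle v = n).
    rewrite (_ : [set s | _] = [set s | tau s = v]) //.
    by apply/seteqP; split=> s /= => [/(pcan_inj pickleK)|->].
  rewrite (_ : [set s | _] = set0) //.
  by apply/seteqP; split=> s //= e; apply: h; exists (tau s).
apply/seteqP; split=> s /= => [Bs|[n [v Bv <-] /(pcan_inj pickleK) ->]//].
by exists (pickle (tau s)) => //; exists (tau s).
Qed.

Lemma measurable_stops tau : adapted_time tau -> measurable [set s | isSome (tau s)].
Proof.
move=> tau_ad; rewrite -[X in measurable X]setTI.
rewrite (_ : [set s | isSome (tau s)] = (fun s => isSome (tau s)) @^-1` [set true]).
  by have /= ms := measurable_adapted_time isSome tau_ad; apply: ms.
by apply/seteqP; split.
Qed.

Lemma adapted_first_time (p : nat -> obs_seq X -> bool) :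
  (forall t, measurable [set s | p t s]) ->
  (forall t s s', (forall i, (i < t)%N -> s i = s' i) -> p t s -> p t s') ->
  adapted_time (fun s => first_time (p^~ s)).
Proof.
move=> mp dp t; split.
  rewrite (_ : [set s | _] = \bigcup_(u in [set u | (u <= t)%N]) [set s | p u s]).
    exact: bigcup_measurable.
  by apply/seteqP; split=> s /= => [/time_le_first_time[u ut pu]|[u ut pu]];
    [exists u | apply/time_le_first_time; exists u].
move=> s s' ss' /time_le_first_time[u ut pu]; apply/time_le_first_time.
by exists u => //; apply: dp pu => i iu; apply: ss'; exact: leq_trans iu ut.
Qed.

End adapted_times.

(** * E-processes and policies *)

Lemma measurable_ge_set (R : realType) (d : measure_display)
    (T : measurableType d) (f : T -> R) (c : R) :
  measurable_fun [set: T] f -> measurable [set x | c <= f x].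
Proof.
move=> mf; rewrite (_ : [set x | _] = setT `&` f @^-1` `[c, +oo[%classic).
  exact: mf.
by rewrite setTI; apply/seteqP; split=> x /=; rewrite in_itv/= andbT.
Qed.

Lemma limn_esup_bounds (R : realType) (u : (\bar R)^nat) (c : \bar R) :
  (forall n, 0 <= u n <= c)%E -> (0 <= limn_esup u <= c)%E.
Proof.
move=> uc; rewrite limn_esup_lim; apply/andP; split.
  apply: lime_ge; first exact: is_cvg_esups.
  apply: nearW => n; apply: (@le_trans _ _ (u n)); first by case/andP: (uc n).
  by apply: ereal_sup_ubound; exists n => //=.
apply: lime_le; first exact: is_cvg_esups.
apply: nearW => n; apply: ge_ereal_sup => _ [m _ <-].
by case/andP: (uc m).
Qed.

(** * E-processes built from a rejection time *)

Section eprocess_of_time.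
Context {R : realType} {d : measure_display} {X : measurableType d}.
Variables (alpha : R) (P : probability (obs_seq X) R).
Variable (tau : obs_seq X -> option nat).
Hypotheses (alpha_gt0 : 0 < alpha) (tau_ad : adapted_time tau).

(* Beyond the history the observations are padded with a junk point. *)
Definition extend t (h : t.-tuple X) : obs_seq X := fun i => nth point h i.

Definition rejection_eprocess t (h : t.-tuple X) : R :=
  if time_le (tau (extend h)) (Some t) then alpha^-1 else 0.

Lemma measurable_extend t : measurable_fun [set: t.-tuple X] (@extend t).
Proof.
apply: measurable_obs_seq => n; have [nt|tn] := ltnP n t.
  rewrite (_ : (fun h => _) = (fun h : t.-tuple X => tnth h (Ordinal nt))).
    exact: measurable_tnth.
  by apply/funext => h; rewrite (tnth_nth point).
rewrite (_ : (fun h => _) = cst point) //.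
by apply/funext => h; rewrite /extend nth_default// size_tuple.
Qed.

Lemma extend_history t (s : obs_seq X) i : (i < t)%N -> extend (history t s) i = s i.
Proof.
by move=> it; rewrite -(tnth_mktuple s (Ordinal it)) (tnth_nth point).
Qed.

(** By adaptedness the event is decided by the first t observations, where the padded history and
    [s] agree. *)
Lemma rejection_eprocess_history t (s : obs_seq X) :
  rejection_eprocess (history t s) =
  if time_le (tau s) (Some t) then alpha^-1 else 0.
Proof.
rewrite /rejection_eprocess; have [_ dt] := tau_ad t.
suff -> : time_le (tau (extend (history t s))) (Some t) = time_le (tau s) (Some t) by [].
by apply/idP/idP; apply: dt => i /extend_history ->.
Qed.

Lemma eprocess_rejection_eprocess (s : obs_seq X) :
  eprocess_rejection alpha rejection_eprocess s = tau s.
Proof.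
apply: time_eqP => t; apply/idP/idP => [/time_le_first_time[u ut]|ts].
  rewrite rejection_eprocess_history; case: ifP => [|_].
    by case: (tau s) => //= n nu _; exact: leq_trans nu ut.
  by rewrite leNgt invr_gt0 alpha_gt0.
apply/time_le_first_time; exists t => //.
by rewrite rejection_eprocess_history ts.
Qed.

(** At every time, finite or not, the process is at most 1/alpha times the indicator that [tau] is
    finite, and this bound has mean at most 1. *)
Lemma e_process_rejection : (P [set s | isSome (tau s)] <= alpha%:E)%E ->
  e_process P rejection_eprocess.
Proof.
move=> Ptau; have alphaV0 : 0 <= alpha^-1 by rewrite invr_ge0 ltW.
have mtau := measurable_stops tau_ad.
split=> [t|t h|sigma _].
- apply: measurable_fun_ifT => //.
  apply: (@measurable_fun_bool _ _ _ _ true); rewrite setTI.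
  rewrite -[X in measurable X]setTI.
  exact: (@measurable_extend t measurableT _ (tau_ad t).1).
- by rewrite /rejection_eprocess; case: ifP.
have U_bnd t s : 0 <= (rejection_eprocess (history t s)) <=
    alpha^-1 * \1_[set s | isSome (tau s)] s.
  rewrite rejection_eprocess_history indicE.
  case: ifP => [ts|_]; last by rewrite lexx mulr_ge0.
  by rewrite alphaV0 mem_set ?mulr1//=; case: (tau s) ts.
have stop_bnd s : (0 <= stopped rejection_eprocess sigma s <=
    (alpha^-1)%:E * (\1_[set s | isSome (tau s)] s)%:E)%E.
  rewrite /stopped; case: (sigma s) => [t|]; first by rewrite -EFinM !lee_fin U_bnd.
  by apply: limn_esup_bounds => t; rewrite -EFinM !lee_fin U_bnd.
apply: (@le_trans _ _ (\int[P]_s ((alpha^-1)%:E * (\1_[set s | isSome (tau s)] s)%:E))%E).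
  by apply: ge0_le_integralT => s; case/andP: (stop_bnd s).
rewrite ge0_integralZl_EFin//; last first.
  by apply/measurable_EFinP; exact: measurable_indic.
rewrite integral_indic// setIT.
rewrite -[leRHS](_ : (alpha^-1)%:E * alpha%:E = 1)%E.
  by rewrite lee_pmul2l// lte_fin invr_gt0.
by rewrite -EFinM mulVf// gt_eqF.
Qed.

End eprocess_of_time.

(** * Wealth processes and Ville's inequality *)

Section policies.
Context {R : realType} {d dA : measure_display}.
Context {X : measurableType d} {A : measurableType dA}.
Variables (alpha : R) (phi : A -> X -> R).
Hypothesis alpha_gt0 : 0 < alpha.
Hypothesis mphi : measurable_fun [set: A * X] (fun z => phi z.1 z.2).
Hypothesis phi_ge0 : forall a x, 0 <= phi a x.
Implicit Type a : forall t : nat, t.-tuple X -> A.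

Lemma measurable_payoff1 (b : A) : measurable_fun [set: X] (phi b).
Proof. by have := measurableT_comp mphi (@pair1_measurable _ _ A X b). Qed.

Lemma measurable_wealth a t : policy a ->
  measurable_fun [set: obs_seq X] (fun s => wealth phi a s t).
Proof.
move=> ma; elim: t => [|t IH] /=; first exact: measurable_cst.
apply: measurable_funM => //.
have mas : measurable_fun [set: obs_seq X] (fun s => (a t (history t s), s t)).
  apply/measurable_fun_pairP; split => /=; last exact: measurable_coordinate.
  exact: measurableT_comp (ma t) (@measurable_history _ X t).
by have := measurableT_comp mphi mas.
Qed.

Lemma eq_history t (s s' : obs_seq X) : (forall i, (i < t)%N -> s i = s' i) ->
  history t s = history t s'.
Proof. by move=> ss'; apply: eq_from_tnth => i; rewrite !tnth_mktuple ss'. Qed.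

Lemma eq_wealth a t (s s' : obs_seq X) : (forall i, (i < t)%N -> s i = s' i) ->
  wealth phi a s t = wealth phi a s' t.
Proof.
elim: t => //= t IH ss'; rewrite ss'// (@eq_history t s s') ?IH// => i it;
by rewrite ss'// ltnS ltnW.
Qed.

Lemma adapted_policy_rejection a : policy a ->
  adapted_time (policy_rejection alpha phi a).
Proof.
move=> ma; apply: adapted_first_time => t.
  case: t => [|t]; first by rewrite (_ : [set s | _] = set0)//; apply/seteqP; split.
  by apply: measurable_ge_set; exact: measurable_wealth.
by move=> s s' ss'; rewrite (eq_wealth a ss').
Qed.

Definition shift_policy a (x : X) : forall t : nat, t.-tuple X -> A :=
  fun t h => a t.+1 [tuple of x :: h].

Lemma policy_shift a x : policy a -> policy (shift_policy a x).
Proof.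
move=> ma t; apply: (measurableT_comp (ma t.+1)).
exact: (@measurable_cons _ _ _ _ (cst x) t id).
Qed.

Lemma wealth_obs_cons a x s t :
  wealth phi a (obs_cons (x, s)) t.+1 =
  phi (a 0%N [tuple]) x * wealth phi (shift_policy a x) s t.
Proof.
elim: t => [|t IH]; first by rewrite /= mul1r mulr1 (tuple0 (history 0 _)).
by rewrite -[LHS]/(wealth phi a (obs_cons (x, s)) t.+1 * _) IH history_obs_cons /= mulrA.
Qed.

Variables (pi : probability X R) (P : probability (obs_seq X) R).
Hypothesis P_prod : is_infinite_product pi P.
Hypothesis phi1 : forall b, (\int[pi]_x (phi b x)%:E = 1)%E.

(** Starting from a general capital [w] lets an induction on [N] absorb the first bet into the
    capital. *)
Let crossing N a w : set (obs_seq X) :=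
  [set s | exists2 t, (t <= N)%N & alpha^-1 <= w * wealth phi a s t].

Let measurable_crossing N a w : policy a -> measurable (crossing N a w).
Proof.
move=> ma; rewrite (_ : crossing N a w = \bigcup_(t in [set t | (t <= N)%N])
  [set s | alpha^-1 <= w * wealth phi a s t]) //.
apply: bigcup_measurable => t _; apply: measurable_ge_set.
by apply: measurable_funM => //; exact: measurable_wealth.
Qed.

(** Given the first observation x, the induction hypothesis bounds the probability by alpha times
    the wealth reached, and this has mean alpha * w because payoffs integrate to 1. *)
Lemma ville_finite N a w : policy a -> 0 <= w ->
  (P (crossing N a w) <= (alpha * w)%:E)%E.
Proof.
elim: N a w => [|N IH] a w ma w0.
(* In both cases of the induction, a capital of at least 1/alpha makes the bound at least 1. *)
all: have [w1|w1] := leP alpha^-1 w;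
  first by apply: (@le_trans _ _ 1%E); [by apply: probability_le1; exact: measurable_crossing |
  rewrite lee_fin -(mulfV (lt0r_neq0 alpha_gt0)) ler_pM2l].
  rewrite (_ : crossing 0 a w = set0) ?measure0 ?lee_fin ?mulr_ge0// 1?ltW//.
  apply/seteqP; split=> // s [[|t] //= _]; rewrite mulr1.
  by rewrite leNgt w1.
rewrite (probability_obs_cons P_prod)//; last exact: measurable_crossing.
(* Below 1/alpha there is no crossing at time 0, so a crossing takes place after the first bet. *)
have crossS x : [set s | crossing N.+1 a w (obs_cons (x, s))] =
    crossing N (shift_policy a x) (w * phi (a 0%N [tuple]) x).
  apply/seteqP; split=> s /= [[|t] tN].
  - by rewrite /= mulr1 leNgt w1.
  - by rewrite wealth_obs_cons mulrA; exists t.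
  - by move=> h; exists 1%N => //; rewrite wealth_obs_cons mulrA.
  - by move=> h; exists t.+2 => //; rewrite wealth_obs_cons mulrA.
apply: (@le_trans _ _ (\int[pi]_x ((alpha * w)%:E * (phi (a 0%N [tuple]) x)%:E))%E).
  apply: ge0_le_integralT => x; first exact: measure_ge0.
  rewrite crossS -EFinM -mulrA; apply: IH; first exact: policy_shift.
  exact: mulr_ge0.
rewrite ge0_integralZl_EFin//.
- by rewrite phi1 mule1.
- by move=> x _; rewrite lee_fin.
- by apply/measurable_EFinP; exact: measurable_payoff1.
- by rewrite mulr_ge0// ltW.
Qed.

(** Continuity from below: the crossings up to [N] increase to a set containing the rejection
    event. *)
Lemma ville a : policy a ->
  (P [set s | isSome (policy_rejection alpha phi a s)] <= alpha%:E)%E.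
Proof.
move=> ma; have mC N := measurable_crossing N 1 ma.
apply: (@le_trans _ _ (P (\bigcup_N crossing N a 1))).
  apply: le_measure; rewrite ?inE.
  - exact: measurable_stops (adapted_policy_rejection ma).
  - exact: bigcup_measurable.
  move=> s /= /first_time_isSome[t /andP[_ ts]].
  by exists t => //; exists t => //; rewrite mul1r.
have cvgP : P (crossing N a 1) @[N --> \oo] --> P (\bigcup_N crossing N a 1).
  apply: nondecreasing_cvg_mu => //; first exact: bigcup_measurable.
  move=> n m nm; apply/subsetPset => s [t tn ts].
  by exists t => //; exact: leq_trans tn nm.
rewrite -(cvg_lim _ cvgP)//; apply: lime_le; first by apply/cvg_ex; eexists; exact: cvgP.
by apply: nearW => N; rewrite -[alpha]mulr1; exact: ville_finite.
Qed.

End policies.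

(** * Markov policies *)

(** What happens after the first success is irrelevant. This allows comparing frozen and unfrozen
    wealth, which may differ once 1/alpha has been reached. *)
Lemma eq_first_time (p q : pred nat) :
  (forall t, (forall u, (u < t)%N -> ~~ p u) -> (forall u, (u < t)%N -> ~~ q u) ->
    p t = q t) ->
  first_time p = first_time q.
Proof.
move=> pq.
(* By induction on the length, [p] and [q] have the same initial segments without success. *)
have H t : (forall u, (u < t)%N -> ~~ p u) <-> (forall u, (u < t)%N -> ~~ q u).
  elim: t => // t IH; split=> h u; rewrite ltnS leq_eqVlt => /predU1P[->|ut].
  - by rewrite -pq ?h// => [v vt|]; [rewrite h// ltnW|apply/IH => v vt; rewrite h// ltnW].
  - by move: u ut; apply/IH => v vt; rewrite h// ltnW.
  - by rewrite pq ?h// => [|v vt]; [apply/IH => v vt; rewrite h// ltnW|rewrite h// ltnW].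
  - by move: u ut; apply/IH => v vt; rewrite h// ltnW.
apply: time_eqP => t; apply/idP/idP => /time_le_first_time[u ut pu];
  apply: contrapT => /time_le_first_time h.
- have /H/(_ u) : forall v, (v < t.+1)%N -> ~~ q v.
    by move=> v vt; apply/negP => qv; apply: h; exists v.
  by rewrite ltnS ut pu => /(_ isT).
- have /H/(_ u) : forall v, (v < t.+1)%N -> ~~ p v.
    by move=> v vt; apply/negP => pv; apply: h; exists v.
  by rewrite ltnS ut pu => /(_ isT).
Qed.

Lemma first_timeS (p : pred nat) : ~~ p 0%N ->
  first_time p = omap succn (first_time (fun t => p t.+1)).
Proof.
move=> p0; apply: time_eqP => t; apply/idP/idP.
  move=> /time_le_first_time[[|u]]; first by rewrite (negPf p0).
  case: t => // t ut pu.
  have : time_le (first_time (fun t => p t.+1)) (Some t).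
    by apply/time_le_first_time; exists u.
  by case: first_time.
case: t => [|t] h; first by case: first_time h.
have /time_le_first_time[u ut pu] : time_le (first_time (fun t => p t.+1)) (Some t).
  by case: first_time h.
by apply/time_le_first_time; exists u.+1.
Qed.

Section markov.
Context {R : realType} {d dA : measure_display}.
Context {X : measurableType d} {A : measurableType dA}.
Variables (alpha : R) (phi : A -> X -> R).
Hypothesis alpha_gt0 : 0 < alpha.
Hypothesis mphi : measurable_fun [set: A * X] (fun z => phi z.1 z.2).
Hypothesis phi_ge0 : forall b x, 0 <= phi b x.
Implicit Types (a : nat -> R -> A) (w : R) (s : obs_seq X).

Fixpoint markov_wealth_from a w s t : R :=
  if t is u.+1 then
    let v := markov_wealth_from a w s u in
    if v < alpha^-1 then v * phi (a u v) (s u) else v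
  else w.

Definition markov_rejection_from a w s : option nat :=
  first_time (fun t => alpha^-1 <= markov_wealth_from a w s t).

Lemma markov_wealth1 a s t :
  markov_wealth alpha phi a s t = markov_wealth_from a 1 s t.
Proof. by elim: t => //= t ->. Qed.

(** Since 1 < 1/alpha, admitting time 0 makes no difference from initial wealth 1. *)
Lemma markov_rejection1 a s : alpha < 1 ->
  markov_rejection alpha phi a s = markov_rejection_from a 1 s.
Proof.
move=> alpha1; apply: eq_first_time => -[|t] _ _ /=; last by rewrite markov_wealth1.
by rewrite leNgt invf_gt1// alpha1.
Qed.

Lemma markov_wealth_from_ge0 a w s t : 0 <= w -> 0 <= markov_wealth_from a w s t.
Proof. by move=> w0; elim: t => //= t IH; case: ifP => // _; exact: mulr_ge0. Qed.

Lemma eq_markov_wealth_from a w t s s' : (forall i, (i < t)%N -> s i = s' i) ->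
  markov_wealth_from a w s t = markov_wealth_from a w s' t.
Proof.
elim: t => //= t IH ss'; rewrite ss'// IH// => i it.
by rewrite ss'// ltnS ltnW.
Qed.

(* A Markov policy is measurable below 1/alpha only; this makes it so everywhere. *)
Let patched a t w : A := if 0 <= w < alpha^-1 then a t w else point.

Let measurable_patched a t : markov_policy alpha a ->
  measurable_fun [set: R] (patched a t).
Proof.
move=> ma; apply: measurable_fun_if => //.
  apply: (@measurable_fun_bool _ _ _ _ true); rewrite setTI.
  rewrite (_ : _ @^-1` _ = `[0, alpha^-1[%classic)//.
rewrite setTI (_ : _ @^-1` _ = `[0, alpha^-1[%classic)//.
Qed.

Lemma measurable_markov_wealth_from a w t : markov_policy alpha a -> 0 <= w ->
  measurable_fun [set: obs_seq X] (fun s => markov_wealth_from a w s t).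
Proof.
move=> ma w0; elim: t => [|t IH]; first exact: measurable_cst.
(* The action is consulted only at wealths in [0, 1/alpha[, where [patched] agrees with [a]. *)
rewrite (_ : (fun s => _) = fun s =>
  if markov_wealth_from a w s t < alpha^-1
  then markov_wealth_from a w s t * phi (patched a t (markov_wealth_from a w s t)) (s t)
  else markov_wealth_from a w s t).
  apply: measurable_fun_ifT => //; first exact: measurable_fun_ltr.
  apply: measurable_funM => //.
  have mp : measurable_fun [set: obs_seq X]
      (fun s => (patched a t (markov_wealth_from a w s t), s t)).
    apply/measurable_fun_pairP; split => /=; last exact: measurable_coordinate.
    exact: measurableT_comp (measurable_patched t ma) IH.
  by have := measurableT_comp mphi mp.
apply/funext => s /=; case: ifP => // wt.
by rewrite /patched markov_wealth_from_ge0// wt.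
Qed.

Lemma adapted_markov_rejection_from a w : markov_policy alpha a -> 0 <= w ->
  adapted_time (markov_rejection_from a w).
Proof.
move=> ma w0; apply: adapted_first_time => t.
  by apply: measurable_ge_set; exact: measurable_markov_wealth_from.
by move=> s s' ss'; rewrite (eq_markov_wealth_from a w ss').
Qed.

(** The current wealth is recovered by replaying the game along the history; wealth at time t never
    reads the padding. *)
Definition policy_of_markov a : forall t : nat, t.-tuple X -> A :=
  fun t h => patched a t (markov_wealth_from a 1 (extend h) t).

Lemma policy_policy_of_markov a : markov_policy alpha a -> policy (policy_of_markov a).
Proof.
move=> ma t; apply: measurableT_comp (measurable_patched t ma) _.
exact: measurableT_comp (measurable_markov_wealth_from t ma ler01) (@measurable_extend _ X t).
Qed.

Lemma policy_of_markov_rejection a s : alpha < 1 ->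
  policy_rejection alpha phi (policy_of_markov a) s = markov_rejection alpha phi a s.
Proof.
move=> alpha1; apply: eq_first_time => t _ h; rewrite markov_wealth1; congr (_ && _).
(* Absence of rejection keeps all earlier wealths below 1/alpha, at time 0 because 1 < 1/alpha;
   hence no freezing has occurred. *)
have {}h u : (u < t)%N -> markov_wealth_from a 1 s u < alpha^-1.
  move=> ut; have := h u ut; rewrite markov_wealth1.
  by case: u {ut} => [|u] /=; rewrite -?ltNge// invf_gt1.
congr (_ <= _); elim: t h => //= t IH h.
rewrite IH => [|u ut]; last by rewrite h// ltnS ltnW.
rewrite h//; congr (_ * phi _ _).
rewrite /policy_of_markov (@eq_markov_wealth_from _ _ _ _ s); last first.
  by move=> i it; exact: extend_history.
by rewrite /patched h// markov_wealth_from_ge0.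
Qed.

Definition shift_markov a : nat -> R -> A := fun t => a t.+1.

Lemma markov_wealth_obs_cons a w x s t : w < alpha^-1 ->
  markov_wealth_from a w (obs_cons (x, s)) t.+1 =
  markov_wealth_from (shift_markov a) (w * phi (a 0%N w) x) s t.
Proof. by move=> w1; elim: t => [|t IH] /=; rewrite ?w1// -IH /= ?w1. Qed.

Lemma markov_rejection_stop a w s : alpha^-1 <= w ->
  markov_rejection_from a w s = Some 0%N.
Proof.
move=> w1; apply: time_eqP => t /=; rewrite leq0n.
by apply/time_le_first_time; exists 0%N.
Qed.

Lemma markov_rejection_obs_cons a w x s : w < alpha^-1 ->
  markov_rejection_from a w (obs_cons (x, s)) =
  omap succn (markov_rejection_from (shift_markov a) (w * phi (a 0%N w) x) s).
Proof.
move=> w1; rewrite /markov_rejection_from first_timeS /= -?ltNge//.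
congr (omap succn (first_time _)); apply/funext => t.
by rewrite -(markov_wealth_obs_cons a x s t w1).
Qed.

End markov.

(** * Countable selection and bets *)

(** The least admissible index is n on a measurable set, namely where [p n] holds and no earlier
    [p k] does. *)
Lemma measurable_selection (R : realType) (dT dA : measure_display)
    (T : measurableType dT) (A : measurableType dA)
    (p : nat -> T -> bool) (b : nat -> A) :
  (forall n, measurable [set w | p n w]) -> (forall w, exists n, p n w) ->
  exists2 h : T -> A, measurable_fun [set: T] h &
    forall w, exists2 n, p n w & h w = b n.
Proof.
move=> mp ex_p; exists (fun w => b (ex_minn (ex_p w))); last first.
  by move=> w; case: ex_minnP => n pn _; exists n.
move=> _ Y mY; rewrite setTI (_ : _ @^-1` Y = \bigcup_(n in [set n | Y (b n)])
    ([set w | p n w] `\` \bigcup_(k in [set k | (k < n)%N]) [set w | p k w])).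
  apply: bigcup_measurable => n _; apply: measurableD => //.
  exact: bigcup_measurable.
apply/seteqP; split=> w /=.
  case: ex_minnP => n pn n_min Yn; exists n => //; split=> // -[k /= kn /n_min].
  by rewrite leqNgt kn.
move=> [n Yn [pn npn]]; case: ex_minnP => m pm m_min.
suff -> : m = n by [].
apply/eqP; rewrite eqn_leq m_min// leqNgt; apply/negP => mn.
by apply: npn; exists m.
Qed.

(* The rationals serve every point that is not the minimum of its level set,
   and the minima of the countably many level sets serve the others. *)
Lemma nondecreasing_countable_approx (R : realType) (g : R -> R) (eps : R) :
  {homo g : v w / v <= w} -> 0 < eps ->
  exists D : nat -> R, forall w, exists2 n, D n <= w & g w <= g (D n) + eps.
Proof.
move=> g_homo eps0.
pose lvl (j : int) := [set v | j%:~R * eps <= g v].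
pose D' (i : int + rat) : R := match i with inl j => inf (lvl j) | inr q => ratr q end.
pose D n := if unpickle n is Some i then D' i else 0.
exists D => w.
suff [i iw gi] : exists2 i, D' i <= w & g w <= g (D' i) + eps.
  by exists (pickle i); rewrite /D pickleK.
(* As g w lies between j * eps and (j + 1) * eps, a point of level j loses at most eps against w. *)
pose j := Num.floor (g w / eps).
have jw : lvl j w by rewrite /lvl /= -ler_pdivlMr// floor_le.
have near_w v : lvl j v -> g w <= g v + eps.
  move=> /= jv; apply: (@le_trans _ _ (j%:~R * eps + eps)); last by rewrite lerD2r.
  rewrite -[X in _ + X]mul1r -mulrDl -ler_pdivrMr//.
  by rewrite -intrD1 ltW// floorD1_gt.
have [[v jv vw]|w_min] := pselect (exists2 v, lvl j v & v < w).
  have [q] := rat_in_itvoo vw; rewrite in_itv/= => /andP[vq qw].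
  exists (inr q); first exact: ltW.
  by apply: near_w; apply: le_trans jv _; apply: g_homo; exact: ltW.
have lb : lbound (lvl j) w.
  by move=> v jv; rewrite leNgt; apply/negP => vw; apply: w_min; exists v.
have inf_lvl : inf (lvl j) = w.
  apply/le_anti/andP; split; last by apply: lb_le_inf => //; exists w.
  by apply: ge_inf => //; exists w.
by exists (inl j); rewrite /= inf_lvl// lerDl ltW.
Qed.

(** * Densities as bets *)

Section density.
Context {R : realType} {d : measure_display} {X : measurableType d}.
Variables (pi : probability X R) (f : X -> R).
Hypothesis mf : measurable_fun [set: X] f.
Hypothesis f_ge0 : forall x, 0 <= f x.
Hypothesis f1 : (\int[pi]_x (f x)%:E = 1)%E.

Definition density_prob (B : set X) : \bar R := (\int[pi]_(x in B) (f x)%:E)%E.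

Let density0 : density_prob set0 = 0%E.
Proof. exact: integral_set0. Qed.

Let density_ge0 B : (0 <= density_prob B)%E.
Proof. by apply: integral_ge0 => x _; rewrite lee_fin. Qed.

Let mfE : measurable_fun [set: X] (EFin \o f).
Proof. exact/measurable_EFinP. Qed.

Let density_sigma_additive : semi_sigma_additive density_prob.
Proof.
move=> F mF tF mUF; rewrite /density_prob ge0_integral_bigcup//.
- by apply: is_cvg_ereal_nneg_natsum_cond => n _ _; exact: density_ge0.
- exact: measurable_funTS.
- by move=> x _; rewrite lee_fin.
Qed.

HB.instance Definition _ := isMeasure.Build _ _ _
  density_prob density0 density_ge0 density_sigma_additive.

Let density_setT : density_prob [set: X] = 1%E.
Proof. exact: f1. Qed.

HB.instance Definition _ :=
  @Measure_isProbability.Build _ _ R density_prob density_setT.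

Lemma density_probability : exists Q : probability X R,
  Q `<< pi /\ forall B, Q B = (\int[pi]_(x in B) (f x)%:E)%E.
Proof.
exists density_prob; split=> //.
apply/null_content_dominatesP => B mB B0; apply: null_set_integral => //.
exact: measurable_funTS.
Qed.

End density.

Section bets.
Context {R : realType} {d : measure_display} {X : measurableType d}.
Variables (pi0 : probability X R) (phi : canonical_action pi0 -> X -> R).
Hypothesis phi_dens : canonical_payoff phi.

Lemma payoff_int1 b : (\int[pi0]_x (phi b x)%:E = 1)%E.
Proof.
have [_ _ /(_ b _ measurableT) <-] := phi_dens.
exact: (probability_setT (dominated_val b)).
Qed.

Lemma measurable_canonical_payoff b : measurable_fun [set: X] (phi b).
Proof. by have [mphi _ _] := phi_dens; exact: measurable_payoff1 mphi b. Qed.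

(** The payoff of the measure with density [f] and [f] itself have equal integrals over all
    measurable sets, so they agree almost everywhere. *)
Lemma density_action (f : X -> R) : measurable_fun [set: X] f ->
  (forall x, 0 <= f x) -> (\int[pi0]_x (f x)%:E = 1)%E ->
  exists nu : canonical_action pi0, \forall x \ae pi0, phi nu x = f x.
Proof.
move=> mf f0 f1.
have [Q [Q_dom QE]] := density_probability mf f0 f1.
pose nu : canonical_action pi0 := Dominated Q_dom.
have [_ phi0 phi_int] := phi_dens.
exists nu.
have mphi : measurable_fun [set: X] (EFin \o phi nu).
  by apply/measurable_EFinP; exact: measurable_canonical_payoff.
have mfE : measurable_fun [set: X] (EFin \o f) by exact/measurable_EFinP.
suff : ae_eq pi0 setT (EFin \o phi nu) (EFin \o f).
  by apply: filterS => x /(_ I) [].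
apply: integral_ae_eq => //.
  apply/integrableP; split=> //.
  by under eq_integral do rewrite /= ger0_norm//; rewrite payoff_int1 ltry.
move=> B _ mB; rewrite -[RHS]QE -[RHS]/(dominated_val nu B).
by rewrite phi_int.
Qed.

(** Bet on q / M, where M is the total mass of [q]: since M <= c, the payoff c * q / M dominates
    [q]. *)
Lemma bet (q : X -> R) (c : R) : measurable_fun [set: X] q ->
  (forall x, 0 <= q x) -> (\int[pi0]_x (q x)%:E <= c%:E)%E ->
  exists nu : canonical_action pi0, \forall x \ae pi0, q x <= c * phi nu x.
Proof.
move=> mq q0 qc; have [_ phi0 _] := phi_dens.
have mqE : measurable_fun [set: X] (EFin \o q) by exact/measurable_EFinP.
have q_ge0 : (0 <= \int[pi0]_x (q x)%:E)%E by apply: integral_ge0 => x _; rewrite lee_fin.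
have c0 : 0 <= c by rewrite -lee_fin (le_trans q_ge0).
have [M ME] : exists M, (\int[pi0]_x (q x)%:E = M%:E)%E.
  exists (fine (\int[pi0]_x (q x)%:E)%E); rewrite fineK// ge0_fin_numE//.
  exact: le_lt_trans qc (ltry _).
have M0 : 0 <= M by rewrite -lee_fin -ME.
have Mc : M <= c by rewrite -lee_fin -ME.
(* With zero mass there is nothing to normalize, but then [q] vanishes almost everywhere and any
   action serves. *)
have [M_eq0|M_neq0] := eqVneq M 0.
  exists point.
  have /(ae_eq_integral_abs _ measurableT mqE) : (\int[pi0]_x `|(q x)%:E| = 0)%E.
    by under eq_integral do rewrite gee0_abs ?lee_fin//; rewrite ME M_eq0.
  by apply: filterS => x /(_ I) [->]; rewrite mulr_ge0.
have [nu nuE] : exists nu : canonical_action pi0, \forall x \ae pi0, phi nu x = M^-1 * q x.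
  apply: density_action.
  - exact: measurable_funM.
  - by move=> x; rewrite mulr_ge0 ?invr_ge0.
  - under eq_integral do rewrite EFinM.
    rewrite ge0_integralZl_EFin ?invr_ge0//; last by move=> x _; rewrite lee_fin.
    by rewrite ME -EFinM mulVf.
exists nu; apply: filterS nuE => x ->.
by rewrite mulrA ler_peMl// ler_pdivlMr ?mul1r// lt_def M_neq0.
Qed.

End bets.

(** * Approximation by Markov policies *)

Lemma stopping_time_of_adapted (d : measure_display) (X : measurableType d)
    (tau : obs_seq X -> option nat) : adapted_time tau -> stopping_time tau.
Proof.
move=> tau_ad t; have [mt dt] := tau_ad t.
exists [set h : t.-tuple X | time_le (tau (extend h)) (Some t)].
  by have := @measurable_extend _ X t measurableT _ mt; rewrite setTI.
rewrite setTI; apply/seteqP; split=> s; apply: dt => i it.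
  by rewrite extend_history.
by rewrite extend_history.
Qed.

(** * Rejection times of e-processes *)

Section eprocess_rejection_times.
Context {R : realType} {d : measure_display} {X : measurableType d}.
Variables (alpha : R) (P : probability (obs_seq X) R).
Variable (U : forall t : nat, t.-tuple X -> R).
Hypotheses (alpha_gt0 : 0 < alpha) (U_eproc : e_process P U).

Lemma adapted_eprocess_rejection : adapted_time (eprocess_rejection alpha U).
Proof.
have [mU _ _] := U_eproc; apply: adapted_first_time => t.
  apply: measurable_ge_set.
  exact: measurableT_comp (mU t) (@measurable_history _ X t).
by move=> s s' /eq_history ->.
Qed.

(** Markov's inequality for the e-process stopped at its own rejection time, where it is at least
    1/alpha. *)
Lemma eprocess_rejection_prob :
  (P [set s | isSome (eprocess_rejection alpha U s)] <= alpha%:E)%E.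
Proof.
have [_ U0 /(_ _ (stopping_time_of_adapted adapted_eprocess_rejection)) U1] := U_eproc.
set S := [set s | _]; have mS : measurable S.
  exact: measurable_stops adapted_eprocess_rejection.
suff : ((alpha^-1)%:E * P S <= 1)%E.
  by rewrite lee_pdivrMl// mule1.
apply: le_trans U1.
rewrite -[S]setIT -integral_indic// -ge0_integralZl_EFin//; last 2 first.
- by apply/measurable_EFinP; exact: measurable_indic.
- by rewrite invr_ge0 ltW.
apply: ge0_le_integralT => s; first by rewrite -EFinM lee_fin mulr_ge0// invr_ge0 ltW.
rewrite -EFinM indicE /stopped.
case tau_s : (eprocess_rejection alpha U s) => [t|].
  rewrite mem_set ?mulr1 ?lee_fin; last by rewrite /S /= tau_s.
  exact: (first_time_Some tau_s).
(* Without rejection the indicator vanishes, and nonnegativity of the limsup suffices. *)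
rewrite memNset ?mulr0; last by rewrite /S /= tau_s.
suff /andP[] : (0 <= limn_esup (fun t => (U (history t s))%:E) <= +oo)%E by [].
by apply: limn_esup_bounds => t; rewrite lee_fin U0 leey.
Qed.

End eprocess_rejection_times.

Lemma integral_cst_probability (R : realType) (d : measure_display)
    (T : measurableType d) (mu : probability T R) (c : R) :
  (\int[mu]_x c%:E = c%:E)%E.
Proof.
rewrite (integral_cst mu measurableT) -[RHS]mule1; congr (_ * _)%E.
exact: probability_setT.
Qed.

Definition shift_reward {R : realType} (r : option nat -> R) : option nat -> R :=
  fun o => r (omap succn o).

(** * Expected rewards and conditioning on the first observation *)

Section expected_rewards.
Context {R : realType} {d : measure_display} {X : measurableType d}.
Implicit Types (r : option nat -> R) (tau : obs_seq X -> option nat).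

Lemma reward_shift r : reward_function r -> reward_function (shift_reward r).
Proof.
move=> [r0 r_mono rN]; split=> [t|s t st|]; rewrite /shift_reward//.
by apply: r_mono; case: s t st => [s|] [t|].
Qed.

Lemma reward_le0 r o : reward_function r -> r o <= r (Some 0%N).
Proof. by move=> [_ r_mono _]; apply: r_mono; case: o. Qed.

Variables (pi : probability X R) (P : probability (obs_seq X) R).

Lemma expected_reward_ge0 r tau : reward_function r ->
  (0 <= expected_reward P r tau)%E.
Proof. by move=> [r0 _ _]; apply: integral_ge0 => s _; rewrite lee_fin. Qed.

Lemma expected_reward_le r r' tau tau' : reward_function r ->
  (forall s, r (tau s) <= r' (tau' s)) ->
  (expected_reward P r tau <= expected_reward P r' tau')%E.
Proof.
by move=> [r0 _ _] rr'; apply: ge0_le_integralT => s; rewrite lee_fin.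
Qed.

Lemma expected_reward0 r : expected_reward P r (fun=> Some 0%N) = (r (Some 0%N))%:E.
Proof. exact: integral_cst_probability. Qed.

Lemma expected_reward_le0 r tau : reward_function r ->
  (expected_reward P r tau <= (r (Some 0%N))%:E)%E.
Proof.
move=> r_rew; rewrite -expected_reward0; apply: expected_reward_le => // s.
exact: reward_le0.
Qed.

Lemma expected_reward_fin_num r tau : reward_function r ->
  expected_reward P r tau \is a fin_num.
Proof.
move=> r_rew; rewrite ge0_fin_numE ?expected_reward_ge0//.
exact: le_lt_trans (expected_reward_le0 _ r_rew) (ltry _).
Qed.

Hypothesis P_prod : is_infinite_product pi P.

Let measurable_reward r tau : adapted_time tau ->
  measurable_fun [set: obs_seq X] (fun s => (r (tau s))%:E).
Proof.
move=> tau_ad; apply/measurable_EFinP.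
exact: (measurable_adapted_time r tau_ad).
Qed.

(** Away from time 0 the truncated predecessor is inverted by the successor inside [shift_reward];
    at 0 the two would give time 1. *)
Let shift_rewardE r tau x s : (forall s, tau s <> Some 0%N) ->
  r (tau (obs_cons (x, s))) = shift_reward r (shift_time tau x s).
Proof.
move=> /(_ (obs_cons (x, s))); rewrite /shift_reward /shift_time.
by case: (tau _) => [[|n]|].
Qed.

Lemma expected_reward_shift r tau : reward_function r -> adapted_time tau ->
  (forall s, tau s <> Some 0%N) ->
  (expected_reward P r tau =
   \int[pi]_x expected_reward P (shift_reward r) (shift_time tau x))%E.
Proof.
move=> [r0 _ _] tau_ad tau0.
rewrite /expected_reward (integral_obs_cons P_prod); last 2 first.
- exact: measurable_reward.
- by move=> s; rewrite lee_fin.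
by apply: eq_integral => x _; apply: eq_integral => s _; rewrite shift_rewardE.
Qed.

Lemma measurable_expected_reward_shift r tau : reward_function r -> adapted_time tau ->
  (forall s, tau s <> Some 0%N) ->
  measurable_fun [set: X]
    (fun x => expected_reward P (shift_reward r) (shift_time tau x)).
Proof.
move=> [r0 _ _] tau_ad tau0.
have := @measurable_integral_obs_cons _ _ _ P (fun s => (r (tau s))%:E)
  (measurable_reward r tau_ad) (fun s => r0 (tau s)).
congr measurable_fun; apply/funext => x; rewrite /expected_reward.
by apply: eq_integral => s _; rewrite shift_rewardE.
Qed.

Lemma stops_shift tau : adapted_time tau ->
  (P [set s | isSome (tau s)] =
   \int[pi]_x P [set s | isSome (shift_time tau x s)])%E /\
  measurable_fun [set: X] (fun x => P [set s | isSome (shift_time tau x s)]).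
Proof.
move=> tau_ad; have mtau := measurable_stops tau_ad.
have E x : [set s | isSome (shift_time tau x s)] =
    [set s | [set s | isSome (tau s)] (obs_cons (x, s))].
  by apply/seteqP; split=> s /=; rewrite /shift_time; case: (tau _).
split.
  rewrite (probability_obs_cons P_prod)//.
  by apply: eq_integral => x _; rewrite E.
have := measurable_probability_obs_cons P mtau.
by congr measurable_fun; apply/funext => x; rewrite E.
Qed.

End expected_rewards.

Lemma ae_dominates (R : realType) (d : measure_display) (T : measurableType d)
    (mu nu : probability T R) (Q : T -> Prop) : nu `<< mu ->
  (\forall x \ae mu, Q x) -> \forall x \ae nu, Q x.
Proof.
move=> /null_content_dominatesP dom [N [mN N0 QN]]; exists N; split=> //.
exact: dom.
Qed.

(** * Affordable times and the optimal value *)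

Section markov_approximation.
Context {R : realType} {d : measure_display} {X : measurableType d}.
Variables (alpha : R) (pi0 pi1 : probability X R) (P0 P1 : probability (obs_seq X) R).
Variable phi : canonical_action pi0 -> X -> R.
Hypotheses (alpha_gt0 : 0 < alpha) (pi1_ac : pi1 `<< pi0).
Hypotheses (P0_prod : is_infinite_product pi0 P0) (P1_prod : is_infinite_product pi1 P1).
Hypothesis phi_dens : canonical_payoff phi.
Implicit Types (r : option nat -> R) (tau : obs_seq X -> option nat).

(** The times that capital [w] can afford: a payment of 1/alpha upon stopping has expectation at
    most [w] under the null. *)
Let feasible w tau :=
  adapted_time tau /\ (P0 [set s | isSome (tau s)] <= (alpha * w)%:E)%E.

Let mphi := let: And3 h _ _ := phi_dens in h.
Let phi_ge0 := let: And3 _ h _ := phi_dens in h.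

Lemma feasible_bet w tau : feasible w tau -> exists nu : canonical_action pi0,
  \forall x \ae pi0, feasible (w * phi nu x) (shift_time tau x).
Proof.
move=> [tau_ad tau_w]; have [tauE mtau] := stops_shift P0_prod tau_ad.
have P_fin x : P0 [set s | isSome (shift_time tau x s)] \is a fin_num.
  exact: fin_num_measure (measurable_stops (adapted_shift_time x tau_ad)).
(* The function to be financed is the null probability of stopping given x; its mean is at most
   alpha * w. *)
have [|||nu nuP] := @bet _ _ _ _ _ phi_dens
    (fun x => fine (P0 [set s | isSome (shift_time tau x s)])) (alpha * w).
- exact: measurableT_comp mtau.
- by move=> x; rewrite fine_ge0.
- by under eq_integral do rewrite fineK//; rewrite -tauE.
exists nu; apply: filterS nuP => x qx; split; first exact: adapted_shift_time.
by rewrite -(fineK (P_fin x)) lee_fin mulrA.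
Qed.

Lemma adapted_never : adapted_time (fun _ : obs_seq X => None).
Proof. by move=> t; split=> //; rewrite (_ : [set s | _] = set0)//; apply/seteqP; split. Qed.

(* The truncation at 0 keeps the set of feasible times nonempty for every w. *)
Let value r w := sup [set fine (expected_reward P1 r tau) | tau in feasible (Num.max 0 w)].

Let value_has_sup r w : reward_function r ->
  has_sup [set fine (expected_reward P1 r tau) | tau in feasible (Num.max 0 w)].
Proof.
move=> r_rew; split.
  exists (fine (expected_reward P1 r (fun=> None))); exists (fun=> None) => //.
  split; first exact: adapted_never.
  rewrite (_ : [set s | _] = set0); last by apply/seteqP; split.
  rewrite measure0 lee_fin; apply: mulr_ge0; first exact: ltW.
  by rewrite le_max lexx.
exists (r (Some 0%N)) => _ [tau _ <-]; rewrite -lee_fin fineK.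
  exact: expected_reward_le0.
exact: expected_reward_fin_num.
Qed.

Let value_ub r w tau : reward_function r -> feasible (Num.max 0 w) tau ->
  (expected_reward P1 r tau <= (value r w)%:E)%E.
Proof.
move=> r_rew tau_w; rewrite -(fineK (expected_reward_fin_num _ _ r_rew)) lee_fin.
by apply: sup_upper_bound; [exact: value_has_sup|exists tau].
Qed.

Let value_homo r : reward_function r -> {homo value r : v w / v <= w}.
Proof.
move=> r_rew v w vw; apply: ge_sup; first by case: (value_has_sup v r_rew).
move=> _ [tau [tau_ad tau_v] <-]; rewrite -lee_fin fineK ?expected_reward_fin_num//.
apply: value_ub => //; split=> //; apply: le_trans tau_v _.
by rewrite lee_fin ler_pM2l// ge_max le_max lexx/= le_max vw orbT.
Qed.

(** The policy is fixed before [w]: wealth after the first bet is arbitrary, so the induction on the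
    horizon needs one policy serving all starting wealths. *)
Lemma markov_approximation N r (eps : R) : 0 < eps -> reward_function r ->
  (forall t, (N <= t)%N -> r (Some t) = 0) ->
  exists2 a : nat -> R -> canonical_action pi0, markov_policy alpha a &
    forall w tau, 0 <= w -> feasible w tau ->
    (expected_reward P1 r tau <=
     expected_reward P1 r (markov_rejection_from alpha phi a w) + eps%:E)%E.
Proof.
elim: N r eps => [|N IH] r eps eps0 r_rew rN.
  exists (fun _ _ => point); first by move=> t; exact: measurable_cst.
  move=> w tau _ _; apply: (@le_trans _ _ (r (Some 0%N))%:E).
    exact: expected_reward_le0.
  by rewrite rN//; apply: adde_ge0; [exact: expected_reward_ge0|rewrite lee_fin ltW].
(* One third each is spent on the inductive policy, on replacing w by some [D n], and on a
   near-optimal time for [D n]. *)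
pose e := eps / 3; have e0 : 0 < e by rewrite divr_gt0.
have [a' ma' a'P] := IH (shift_reward r) e e0 (reward_shift r_rew)
  (fun t Nt => rN t.+1 Nt).
have [D DP] := nondecreasing_countable_approx (value_homo r_rew) e0.
have tauP n : exists tau, feasible (Num.max 0 (D n)) tau /\
    ((value r (D n))%:E <= expected_reward P1 r tau + e%:E)%E.
  have [_ [tau tau_n <-] tau_val] := sup_adherent e0 (value_has_sup (D n) r_rew).
  exists tau; split=> //.
  rewrite -(fineK (expected_reward_fin_num _ _ r_rew)) -EFinD lee_fin.
  by rewrite -lerBlDr ltW.
have [tau_ tau_P] := choice tauP.
have [b bP] := choice (fun n => feasible_bet (tau_P n).1).
(* At wealth w the first bet is one designed for some [D n] below w of nearly the same value. The
   conditions are measurable in w because [value r] is monotone. *)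
have [|w|h mh hP] := @measurable_selection R _ _ R (canonical_action pi0)
    (fun n w => (D n <= w) && (value r w <= value r (D n) + e)) b.
- move=> n; have mv : measurable_fun [set: R] (value r).
    exact: nondecreasing_measurable (value_homo r_rew).
  rewrite (_ : [set w | _] = [set w | D n <= w] `&`
      [set w | - (value r (D n) + e) <= - value r w]); last first.
    by apply/seteqP; split=> w /=; rewrite lerN2 => /andP.
  apply: measurableI; apply: measurable_ge_set => //.
  exact: measurableT_comp mv.
- by have [n Dn vn] := DP w; exists n; rewrite Dn.
pose a t := if t is u.+1 then a' u else h.
exists a.
  move=> [|t]; [exact: measurable_funTS|exact: ma'].
move=> w tau w0 tau_w.
(* From 1/alpha on the run stops at time 0 and collects the largest reward. *)
have [w1|w1] := leP alpha^-1 w.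
  rewrite (_ : markov_rejection_from _ _ _ _ = fun=> Some 0%N); last first.
    by apply/funext => s; exact: markov_rejection_stop.
  rewrite expected_reward0; apply: le_trans (expected_reward_le0 _ _ r_rew) _.
  by rewrite leeDl// lee_fin ltW.
have max0w : Num.max 0 w = w by exact/max_idPr.
have [n /andP[Dnw vn] hw] := hP w.
have Dw : Num.max 0 (D n) <= w by rewrite ge_max w0.
have [tau_n tau_v] := tau_P n.
have ma : markov_policy alpha a by move=> [|t]; [exact: measurable_funTS|exact: ma'].
have aw_ad := adapted_markov_rejection_from mphi phi_ge0 ma w0.
have aw0 s : markov_rejection_from alpha phi a w s <> Some 0%N.
  by rewrite -(obs_consK s) markov_rejection_obs_cons//; case: markov_rejection_from.
have aw_shift x : shift_time (markov_rejection_from alpha phi a w) x =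
    markov_rejection_from alpha phi a' (w * phi (b n) x).
  apply/funext => s; rewrite /shift_time markov_rejection_obs_cons// /= hw.
  by rewrite -[shift_markov a]/a'; case: markov_rejection_from.
(* Stopping surely at time 0 would have null probability 1, beyond the budget, which is at most
   alpha * w < 1. *)
have tau_n0 s : tau_ n s <> Some 0%N.
  have [tau0|] := adapted_time0 tau_n.1; last exact.
  have := tau_n.2; rewrite (_ : [set s | _] = setT); last first.
    by apply/seteqP; split=> s' //= _; rewrite tau0.
  rewrite (probability_setT P0) lee_fin -ler_pdivrMl// mulr1 leNgt.
  by rewrite (le_lt_trans Dw w1).
(* Both sides are integrals over the first observation x, and the induction hypothesis compares the
   integrands for almost every x. *)
have step : (expected_reward P1 r (tau_ n) <=
    expected_reward P1 r (markov_rejection_from alpha phi a w) + e%:E)%E.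
  rewrite (expected_reward_shift P1_prod r_rew tau_n.1 tau_n0).
  rewrite (expected_reward_shift P1_prod r_rew aw_ad aw0).
  have maw := measurable_expected_reward_shift P1 r_rew aw_ad aw0.
  rewrite -[X in (_ <= _ + X)%E](integral_cst_probability pi1).
  have r'_rew := reward_shift r_rew.
  rewrite -ge0_integralD//; last 2 first.
  - by move=> x _; exact: expected_reward_ge0.
  - by move=> x _; rewrite lee_fin ltW.
  apply: ae_ge0_le_integral => //.
  - by move=> x _; exact: expected_reward_ge0.
  - exact: measurable_expected_reward_shift tau_n.1 tau_n0.
  - move=> x _; apply: adde_ge0; first exact: expected_reward_ge0.
    by rewrite lee_fin ltW.
  - exact: emeasurable_funD.
  (* The bet finances the shifted time for [pi0]-almost every x, hence for [pi1]-almost every x. *)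
  apply: (ae_dominates pi1_ac); apply: filterS (bP n) => x [x_ad x_le] _.
  rewrite aw_shift; apply: a'P; first exact: mulr_ge0.
  (* As w is at least [Num.max 0 (D n)], the same bet placed with w pays at least as much. *)
  by split=> //; apply: le_trans x_le _; rewrite lee_fin ler_pM2l// ler_wpM2r.
apply: (@le_trans _ _ (value r w)%:E); first by apply: value_ub; rewrite ?max0w.
apply: (@le_trans _ _ ((value r (D n))%:E + e%:E)%E); first by rewrite -EFinD lee_fin.
have -> : eps%:E = (e%:E + e%:E + e%:E)%E.
  by rewrite -!EFinD; congr EFin; rewrite /e; field.
rewrite !addeA leeD2r//; apply: le_trans tau_v _; rewrite leeD2r//.
Qed.

End markov_approximation.

(** * Reduction to a finite horizon *)

Section truncation.
Context {R : realType} {d : measure_display} {X : measurableType d}.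
Variable (P : probability (obs_seq X) R).
Implicit Types (r : option nat -> R) (tau : obs_seq X -> option nat).

Definition truncate_reward N r : option nat -> R :=
  fun o => if o is Some t then if (t < N)%N then r o else 0 else 0.

Lemma reward_truncate N r : reward_function r -> reward_function (truncate_reward N r).
Proof.
move=> [r0 r_mono rN]; split=> [[t|]|[s|] [t|] st|] //=.
- by case: ifP.
- case: ifP => [tN|_]; last by case: ifP.
  by rewrite (leq_ltn_trans st tN) r_mono.
- by case: ifP.
Qed.

Lemma truncate_reward_le N r o : reward_function r -> truncate_reward N r o <= r o.
Proof. by move=> [r0 _ _]; case: o => [t|] //=; case: ifP. Qed.

(** Monotone convergence: along each sequence the truncated rewards increase and become constant,
    with limit 0 at an infinite time, where [r] vanishes. *)
Lemma truncate_reward_cvg r tau : reward_function r -> adapted_time tau ->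
  expected_reward P (truncate_reward N r) tau @[N --> \oo] -->
  expected_reward P r tau.
Proof.
move=> r_rew tau_ad; have [r0 _ rN] := r_rew.
rewrite /expected_reward.
have -> : (\int[P]_s (r (tau s))%:E =
    \int[P]_s limn (fun N => (truncate_reward N r (tau s))%:E))%E.
  apply: eq_integral => s _; symmetry; apply/cvg_lim => //.
  case: (tau s) => [t|] /=; last by rewrite rN; exact: cvg_cst.
  apply: cvg_near_cst; near=> N; rewrite ifT//.
  by near: N; exact: nbhs_infty_gt.
apply: (@cvg_monotone_convergence _ _ _ P _ measurableT
  (fun N s => (truncate_reward N r (tau s))%:E)).
- move=> N; apply/measurable_EFinP.
  exact: (measurable_adapted_time (truncate_reward N r) tau_ad).
- by move=> N s _; rewrite lee_fin; have [+ _ _] := reward_truncate N r_rew; exact.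
move=> s _ N M NM; rewrite lee_fin /truncate_reward; case: (tau s) => [t|] //.
by case: ifP => [tN|_]; [rewrite (leq_trans tN NM)|case: ifP].
Unshelve. all: by end_near. Qed.

End truncation.

(** * The cycle of inequalities between the three suprema *)

Theorem theorem2 (R : realType) (d : measure_display) (X : measurableType d)
    (X_borel : standard_borel R X)
    (alpha : R) (alpha_gt0 : 0 < alpha) (alpha_lt1 : alpha < 1)
    (pi0 pi1 : probability X R) (pi1_ac : pi1 `<< pi0)
    (P0 P1 : probability (obs_seq X) R)
    (P0_prod : is_infinite_product pi0 P0)
    (P1_prod : is_infinite_product pi1 P1)
    (phi : canonical_action pi0 -> X -> R) (phi_dens : canonical_payoff phi)
    (r : option nat -> R) (r_reward : reward_function r) :
  ereal_sup [set expected_reward P1 r (eprocess_rejection alpha U) |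
              U in [set U : forall t : nat, t.-tuple X -> R | e_process P0 U]]
  = ereal_sup [set expected_reward P1 r (policy_rejection alpha phi A) |
              A in [set A : forall t : nat, t.-tuple X -> canonical_action pi0
                    | policy A]]
  /\
  ereal_sup [set expected_reward P1 r (policy_rejection alpha phi A) |
              A in [set A : forall t : nat, t.-tuple X -> canonical_action pi0
                    | policy A]]
  = ereal_sup [set expected_reward P1 r (markov_rejection alpha phi a) |
              a in [set a : nat -> R -> canonical_action pi0
                    | markov_policy alpha a]].
Proof.
have [mphi phi_ge0 _] := phi_dens.
set VE := ereal_sup _; set VA := ereal_sup _; set VM := ereal_sup _.
have VAE : (VA <= VE)%E.
  apply: ereal_sup_le => _ [A /= mA <-].
  have A_ad := adapted_policy_rejection alpha mphi mA.
  exists (rejection_eprocess alpha (policy_rejection alpha phi A)) => /=.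
    apply: e_process_rejection => //.
    by apply: (ville alpha_gt0 mphi phi_ge0 P0_prod) => // b; exact: payoff_int1.
  congr expected_reward; apply/funext => s.
  exact: eprocess_rejection_eprocess.
have VMA : (VM <= VA)%E.
  apply: ereal_sup_le => _ [a /= ma <-].
  exists (policy_of_markov alpha phi a) => /=.
    exact: policy_policy_of_markov.
  congr expected_reward; apply/funext => s.
  exact: policy_of_markov_rejection.
have VEM : (VE <= VM)%E.
  apply: ge_ereal_sup => _ [U /= U_eproc <-].
  have tau_ad := adapted_eprocess_rejection alpha U_eproc.
  have tau_P := eprocess_rejection_prob alpha_gt0 U_eproc.
  have cvgE := @truncate_reward_cvg _ _ _ P1 _ _ r_reward tau_ad.
  rewrite -(cvg_lim _ cvgE)//; apply: lime_le; first by apply/cvg_ex; eexists; exact: cvgE.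
  (* It suffices to bound each truncated reward up to an arbitrary eps, which is the setting of
     [markov_approximation]. *)
  apply: nearW => N; apply/lee_addgt0Pr => eps eps0.
  have rN_rew := reward_truncate N r_reward.
  have [|a ma aP] := markov_approximation alpha_gt0 pi1_ac P0_prod P1_prod phi_dens
    eps0 rN_rew (N := N).
    by move=> t /=; rewrite ltnNge => ->.
  (* Initial wealth 1 has budget alpha, the bound in [tau_P]. *)
  apply: le_trans (aP 1 _ ler01 _) _; first by rewrite mulr1.
  rewrite leeD2r//; apply: (@le_trans _ _ (expected_reward P1 r (markov_rejection alpha phi a))).
    apply: expected_reward_le => // s; rewrite markov_rejection1//.
    exact: truncate_reward_le.
  by apply: ereal_sup_ubound; exists a.
split; apply/le_anti/andP; split=> //.
  exact: le_trans VEM VMA.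
exact: le_trans VAE VEM.
Qed.
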